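(* Let $n\ge 1$ and $k\ge 2$ be integers. Every $k$-partition matrix $X\in\mathcal{Q}_{n,k}$ is an attractive fixed point of the map $T'$ on $\mathcal{L}_{n,k}$ defined by $$T'(X)=\operatorname*{argmax}_{Y\in\mathcal{L}_{n,k}} (X+A)\cdot Y,$$ where $A$ is the $n\times n$ matrix all of whose entries equal $a=(1-k/2)/(k-1)$.
   Context: Let $\mathcal{S}(n) \subset \mathbb{R}^{n\times n}$ be the set of symmetric $n\times n$ real matrices. For $n \times n$ matrices $X,Y$, write $X\cdot Y = \sum_{i=1}^n\sum_{j=1}^n X_{i,j}Y_{i,j}$ and $\|X\|=\sqrt{X\cdot X}$. The $k$-way elliptope is $$\mathcal{L}_{n,k} = \{X \in \mathcal{S}(n) \mid X \succcurlyeq 0,\ X_{i,i}=1 \text{ for all } i,\ X_{i,j}\ge -1/(k-1) \text{ for all } i,j\},$$ where $X \succcurlyeq 0$ means positive semidefinite. Let $a_1,\ldots,a_k$ be the vertices of an equilateral (regular) simplex in $\mathbb{R}^{k-1}$ centered at the origin and scaled so that $\|a_i\|=1$; thus $a_i\cdot a_j=-1/(k-1)$ for $i\ne j$. The set of $k$-partition matrices $\mathcal{Q}_{n,k}$ is the set of Gram matrices of $n$ vectors $(y_1,\ldots,y_n)$ with $y_i\in\{a_1,\ldots,a_k\}$ for $1\le i\le n$. The $y_i$ need not use all of $a_1,\ldots,a_k$. The argmax defining $T'$ may fail to be unique, in which case $T'(X)$ is set valued; writing $Y=T'(X)$ allows $Y$ to be any element of the argmax. A fixed point of $T'$ is an $X\in\mathcal{L}_{n,k}$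 with $X=T'(X)$ in this sense. A fixed point $x$ of a map $f:\Delta\to\Delta$ is attractive if there exists $\epsilon>0$ such that for every $x_0\in\Delta$ with $\|x-x_0\|<\epsilon$, iteration with $f$ starting at $x_0$ converges to $x$; here $\Delta=\mathcal{L}_{n,k}$, $f=T'$, and this means that every sequence $\{X_t\}_{t\ge 0}$ with $X_0=x_0$ and $X_{t+1}=T'(X_t)$ (any element of the argmax) converges to $x$. *)

(* Defs.v *)
From HB Require Import structures.
From mathcomp Require Import all_boot all_order all_algebra.
From mathcomp Require Import all_classical all_reals topology normedtype.

Set Implicit Arguments.
Unset Strict Implicit.
Unset Printing Implicit Defensive.

Import Order.TTheory GRing.Theory Num.Theory.
Import numFieldNormedType.Exports.

Local Open Scope classical_set_scope.
Local Open Scope ring_scope.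

(* Used for square matrices and, on 'rV_p, as the Euclidean inner product. *)
Definition frobdot (R : realType) (m p : nat) (X Y : 'M[R]_(m, p)) : R :=
  \sum_(i < m) \sum_(j < p) X i j * Y i j.

(* The library's norm `|X| on matrices is the sup norm, not this one. *)
Definition frobnorm (R : realType) (m p : nat) (X : 'M[R]_(m, p)) : R :=
  Num.sqrt (frobdot X X).

Definition possemidef (R : realType) (n : nat) (X : 'M[R]_n) : Prop :=
  forall v : 'cV[R]_n, 0 <= (v^T *m X *m v) 0 0.

Definition elliptope (R : realType) (n k : nat) : set 'M[R]_n :=
  [set X | [/\ X^T = X,
               possemidef X,
               forall i, X i i = 1 &
               forall i j, - 1 / (k%:R - 1) <= X i j]].
Arguments elliptope : clear implicits.

(* k equidistant points in dimension k - 1 are the vertices of a regular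
   simplex; they are automatically affinely independent since 0 < d. *)
Definition unit_regular_simplex (R : realType) (k : nat)
    (a : 'I_k -> 'rV[R]_(k.-1)) : Prop :=
  [/\ exists2 d : R, 0 < d & forall i j, i != j -> frobnorm (a i - a j) = d,
      \sum_(i < k) a i = 0 &
      forall i, frobnorm (a i) = 1].

Definition gram (R : realType) (n p : nat) (y : 'I_n -> 'rV[R]_p) : 'M[R]_n :=
  \matrix_(i < n, j < n) frobdot (y i) (y j).

(* The unit regular simplex centered at 0 is unique up to isometry, so the
   Gram matrices do not depend on which one is chosen. *)
Definition partition_matrices (R : realType) (n k : nat) : set 'M[R]_n :=
  [set X | exists2 a : 'I_k -> 'rV[R]_(k.-1), unit_regular_simplex a &
           exists2 y : 'I_n -> 'rV[R]_(k.-1),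
             (forall i, range a (y i)) & X = gram y].
Arguments partition_matrices : clear implicits.

Definition argmax (R : realType) (T : Type) (D : set T) (f : T -> R) : set T :=
  [set y | D y /\ forall z, D z -> f z <= f y].

Definition shift_mx (R : realType) (n k : nat) : 'M[R]_n :=
  const_mx ((1 - k%:R / 2) / (k%:R - 1)).
Arguments shift_mx : clear implicits.

Definition Tprime (R : realType) (n k : nat) (X : 'M[R]_n) : set 'M[R]_n :=
  argmax (elliptope R n k) (frobdot (X + shift_mx R n k)).
Arguments Tprime R n k X : clear implicits.

(* Set-valued maps: "x = F x" is read as membership of x in F x. *)
Definition fixed_point (R : realType) (n : nat)
    (D : set 'M[R]_n) (F : 'M[R]_n -> set 'M[R]_n) (x : 'M[R]_n) : Prop :=
  D x /\ F x x.

(* Convergence is required of every orbit, u (t + 1) being any element of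
   F (u t). *)
Definition attractive_fixed_point (R : realType) (n : nat)
    (D : set 'M[R]_n) (F : 'M[R]_n -> set 'M[R]_n) (x : 'M[R]_n) : Prop :=
  fixed_point D F x /\
  exists2 e : R, 0 < e &
    forall x0, D x0 -> frobnorm (x - x0) < e ->
    forall u : nat -> 'M[R]_n, u 0%N = x0 -> (forall t, F (u t) (u t.+1)) ->
      frobnorm (u t - x) @[t --> \oo] --> (0 : R).

(* Main.v *)
(** The entries of a [k]-partition matrix [X] are [1] and [- b] with
    [b = 1 / (k - 1)], and the shift [A] is minus the midpoint of these two
    values, so the entries of [X + A] are [c] and [- c] with
    [c = k / (2 (k - 1))]. If [Z] is closer than [c] to [X], the entries of
    [Z + A] and [X + A] have the same signs; as every entry of a matrix of the
    elliptope lies in [[- b, 1]], [X] maximizes each term of [(Z + A) . Y]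
    separately and strictly. Hence [T'(Z) = {X}], and every orbit starting
    within distance [c] of [X] reaches [X] after one step. *)
Require Import Defs.
From HB Require Import structures.
From mathcomp Require Import all_boot all_order all_algebra.
From mathcomp Require Import all_classical all_reals topology normedtype.
From mathcomp Require Import ring lra.

Set Implicit Arguments.
Unset Strict Implicit.
Unset Printing Implicit Defensive.

Import Order.TTheory GRing.Theory Num.Theory.
Import numFieldNormedType.Exports.

Local Open Scope classical_set_scope.
Local Open Scope ring_scope.

Lemma frobdotxx_ge0 (R : realType) (m p : nat) (X : 'M[R]_(m, p)) :
  0 <= frobdot X X.
Proof.
by apply: sumr_ge0 => i _; apply: sumr_ge0 => j _; rewrite -expr2 sqr_ge0.
Qed.

Lemma sqr_frobnorm (R : realType) (m p : nat) (X : 'M[R]_(m, p)) :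
  frobnorm X ^+ 2 = frobdot X X.
Proof. by rewrite sqr_sqrtr // frobdotxx_ge0. Qed.

(** Turns closeness in the Frobenius norm into closeness of every entry, which is what the sign
    argument needs. *)
Lemma normr_le_frobnorm (R : realType) (m p : nat) (X : 'M[R]_(m, p)) i j :
  `|X i j| <= frobnorm X.
Proof.
rewrite -sqrtr_sqr ler_wsqrtr // /frobdot (bigD1 i) //= (bigD1 j) //= -expr2.
rewrite -addrA lerDl addr_ge0 // ?sumr_ge0 // => [l _|l _].
  by rewrite -expr2 sqr_ge0.
by apply: sumr_ge0 => r _; rewrite -expr2 sqr_ge0.
Qed.

Lemma frobdot_rowE (R : realType) (p : nat) (u v : 'rV[R]_p) :
  frobdot u v = (u *m v^T) 0 0.
Proof. by rewrite /frobdot big_ord1 mxE; apply: eq_bigr => j _; rewrite mxE. Qed.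

(** With the vectors as rows of [M], the factorization [M *m M^T] yields both symmetry and positive
    semidefiniteness. *)
Lemma gram_mulmx_tr (R : realType) (n p : nat) (y : 'I_n -> 'rV[R]_p) :
  gram y = (\matrix_(i < n) y i) *m (\matrix_(i < n) y i)^T.
Proof.
apply/matrixP => i j; rewrite !mxE frobdot_rowE mxE.
by apply: eq_bigr => l _; rewrite !mxE.
Qed.

Lemma gram_possemidef (R : realType) (n p : nat) (y : 'I_n -> 'rV[R]_p) :
  possemidef (gram y).
Proof.
move=> v; rewrite gram_mulmx_tr; set M := (\matrix_(i < n) y i).
suff -> : v^T *m (M *m M^T) *m v = (v^T *m M) *m (v^T *m M)^T.
  by rewrite -frobdot_rowE frobdotxx_ge0.
by rewrite trmx_mul trmxK !mulmxA.
Qed.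

Lemma gram_sym (R : realType) (n p : nat) (y : 'I_n -> 'rV[R]_p) :
  (gram y)^T = gram y.
Proof. by rewrite gram_mulmx_tr trmx_mul trmxK. Qed.

Lemma simplex_dot_self (R : realType) (k : nat) (a : 'I_k -> 'rV[R]_(k.-1)) i :
  unit_regular_simplex a -> frobdot (a i) (a i) = 1.
Proof. by case=> _ _ a1; rewrite -sqr_frobnorm a1 expr1n. Qed.

(** Unit norms and a common distance [d] force one common product [s = 1 - d ^+ 2 / 2] for distinct
    vertices. Pairing [a i] with the vanishing sum of all vertices gives [1 + (k - 1) s = 0]. *)
Lemma simplex_dot_neq (R : realType) (k : nat) (a : 'I_k -> 'rV[R]_(k.-1)) i j :
  (2 <= k)%N -> unit_regular_simplex a -> i != j ->
  frobdot (a i) (a j) = - 1 / (k%:R - 1).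
Proof.
move=> k2 sa ij; have a1 l := simplex_dot_self l sa.
case: sa => -[d _ ad] a0 _.
have dotE l m : l != m -> frobdot (a l) (a m) = 1 - d ^+ 2 / 2.
  move=> /ad da; have := sqr_frobnorm (a l - a m); rewrite da.
  have -> : frobdot (a l - a m) (a l - a m) =
      frobdot (a l) (a l) + frobdot (a m) (a m) - 2 * frobdot (a l) (a m).
    rewrite /frobdot !big_ord1 mulr_sumr -big_split -sumrB /=.
    by apply: eq_bigr => r _; rewrite !mxE; ring.
  by rewrite !a1 => ->; field.
have : \sum_m frobdot (a i) (a m) = 0.
  under eq_bigr do rewrite frobdot_rowE.
  by rewrite -summxE -mulmx_sumr -linear_sum /= a0 trmx0 mulmx0 mxE.
rewrite (bigD1 i) //= a1 (eq_bigr (fun=> 1 - d ^+ 2 / 2)); last first.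
  by move=> m; rewrite eq_sym => /dotE.
rewrite sumr_const cardC1 card_ord -(dotE _ _ ij) -[_ *+ k.-1]mulr_natr => sum0.
have kE : k%:R = k.-1%:R + 1 :> R by rewrite natr1 prednK // ltnW.
have k1 : k.-1%:R != 0 :> R by rewrite pnatr_eq0 -lt0n -ltnS prednK // ltnW.
rewrite kE addrK; apply: (mulIf k1); rewrite divfK //; lra.
Qed.

Lemma partition_matrices_elliptope (R : realType) (n k : nat) :
  (2 <= k)%N -> partition_matrices R n k `<=` elliptope R n k.
Proof.
move=> k2 _ [a sa [y ya ->]].
have k1 : 0 < k%:R - 1 :> R by rewrite subr_gt0 ltr1n.
split; [exact: gram_sym|exact: gram_possemidef|move=> i|move=> i j].
  by rewrite mxE; have [l _ <-] := ya i; exact: simplex_dot_self.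
rewrite mxE; have [l _ <-] := ya i; have [m _ <-] := ya j.
have [->|lm] := eqVneq l m; last by rewrite simplex_dot_neq.
rewrite simplex_dot_self // mulNr mul1r.
by rewrite (le_trans _ ler01) // oppr_le0 invr_ge0 ltW.
Qed.

Lemma partition_matrices_entry (R : realType) (n k : nat) (X : 'M[R]_n) i j :
  (2 <= k)%N -> partition_matrices R n k X ->
  X i j = 1 \/ X i j = - 1 / (k%:R - 1).
Proof.
move=> k2 [a sa [y ya ->]]; rewrite mxE.
have [l _ <-] := ya i; have [m _ <-] := ya j.
have [->|lm] := eqVneq l m; [left|right]; first exact: simplex_dot_self.
exact: simplex_dot_neq.
Qed.

(** Testing positive semidefiniteness on the difference of two basis vectors gives
    [0 <= 2 - 2 * Y i j], by symmetry and the unit diagonal. *)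
Lemma elliptope_le1 (R : realType) (n k : nat) (Y : 'M[R]_n) i j :
  elliptope R n k Y -> Y i j <= 1.
Proof.
case=> Ysym /(_ (delta_mx i 0 - delta_mx j 0)) Ypos Ydiag _.
have dE r s : ((delta_mx r 0 : 'cV[R]_n)^T *m Y *m (delta_mx s 0 : 'cV_n)) 0 0
    = Y r s by rewrite trmx_delta -rowE -colE !mxE.
have Yji : Y j i = Y i j by rewrite -[in LHS]Ysym mxE.
move: Ypos; rewrite [_^T]linearB /= !mulmxBl !mulmxBr.
have BE (U V : 'M[R]_1) : (U - V) 0 0 = U 0 0 - V 0 0 by rewrite !mxE.
rewrite !BE !dE Yji !Ydiag; lra.
Qed.

(** A second maximizer [Y] has the same total as [X], so the termwise gaps, all nonnegative, sum to
    0. Each gap is then 0, and the nonzero weight cancels. *)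
Lemma argmax_entrywise (R : realType) (n : nat) (D : set 'M[R]_n)
    (W X Y : 'M[R]_n) :
  D X -> (forall Z, D Z -> forall i j, W i j * Z i j <= W i j * X i j) ->
  (forall i j, W i j != 0) ->
  argmax D (frobdot W) Y <-> Y = X.
Proof.
move=> DX WX W0.
have maxX Z : D Z -> frobdot W Z <= frobdot W X.
  by move=> DZ; apply: ler_sum => i _; apply: ler_sum => j _; exact: WX.
split=> [[DY /(_ _ DX) XY]|->]; last by [].
have entry_ge0 i j : 0 <= W i j * X i j - W i j * Y i j.
  by rewrite subr_ge0 WX.
have row_ge0 i : 0 <= \sum_j (W i j * X i j - W i j * Y i j).
  by apply: sumr_ge0 => j _; exact: entry_ge0.
have : \sum_i \sum_j (W i j * X i j - W i j * Y i j) = 0.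
  under eq_bigr do rewrite sumrB.
  by rewrite sumrB; apply/eqP; rewrite subr_eq0 eq_le maxX // andbT.
move/psumr_eq0P => sum0; apply/matrixP => i j.
have /psumr_eq0P row0 := sum0 (fun i _ => row_ge0 i) i isT.
have /eqP := row0 (fun j _ => entry_ge0 i j) j isT.
by rewrite -mulrBr mulf_eq0 (negPf (W0 i j)) subr_eq0 => /eqP.
Qed.

Lemma Tprime_near_partition (R : realType) (n k : nat) (X Z Y : 'M[R]_n) :
  (2 <= k)%N -> partition_matrices R n k X ->
  frobnorm (X - Z) < k%:R / 2 / (k%:R - 1) ->
  Tprime R n k Z Y <-> Y = X.
Proof.
move=> k2 pX XZ.
have k1 : k%:R - 1 != 0 :> R by rewrite subr_eq0 pnatr_eq1 gtn_eqF.
set b : R := - 1 / (k%:R - 1).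
set c : R := k%:R / 2 / (k%:R - 1) in XZ.
have shift1 : 1 + (1 - k%:R / 2) / (k%:R - 1) = c by rewrite /c; field.
have shiftb : b + (1 - k%:R / 2) / (k%:R - 1) = - c by rewrite /b /c; field.
(* Each entry of [X] is the end of [[b, 1]] favoured by the sign of the weight there; moving from
   [X] to [Z] changes the weight [c] or [- c] by less than [c]. *)
have entry i j : X i j = 1 /\ 0 < (Z + shift_mx R n k) i j \/
    X i j = b /\ (Z + shift_mx R n k) i j < 0.
  have := le_lt_trans (normr_le_frobnorm (X - Z) i j) XZ.
  rewrite !mxE ltr_norml => /andP[].
  have [->|->] := partition_matrices_entry i j k2 pX; rewrite -/b; [left|right].
    by split=> //; lra.
  by split=> //; lra.
apply: argmax_entrywise; first exact: partition_matrices_elliptope.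
  move=> V eV i j; have [[-> W0]|[-> W0]] := entry i j.
    by rewrite ler_pM2l // (elliptope_le1 i j eV).
  by rewrite ler_nM2l //; case: eV.
by move=> i j; have [[_ /gt_eqF->]|[_ /lt_eqF->]] := entry i j.
Qed.

Theorem proposition8 (R : realType) (n k : nat) (hn : (1 <= n)%N)
    (hk : (2 <= k)%N) (X : 'M[R]_n) (hX : partition_matrices R n k X) :
  attractive_fixed_point (elliptope R n k) (Tprime R n k) X.
Proof.
have c0 : 0 < k%:R / 2 / (k%:R - 1) :> R.
  by rewrite !divr_gt0 ?subr_gt0 ?ltr1n // ltr0n ltnW.
have norm0 : frobnorm (X - X) = 0.
  rewrite subrr /frobnorm /frobdot big1 ?sqrtr0 // => i _.
  by rewrite big1 // => j _; rewrite mxE mul0r.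
(* [X] lies in its own ball: this gives fixedness, and later that an orbit having reached [X] stays
   there. *)
have XX : frobnorm (X - X) < k%:R / 2 / (k%:R - 1) by rewrite norm0.
split.
  split; first exact: partition_matrices_elliptope.
  exact/(Tprime_near_partition X hk hX XX).
exists (k%:R / 2 / (k%:R - 1)) => // x0 _ x0X u u0 uT.
(* Only from index 1 on: the starting point [u 0 = x0] may differ from [X]. *)
have uX t : u t.+1 = X.
  elim: t => [|t IHt]; have := uT _.
    by move=> /(_ 0%N); rewrite u0 => /(Tprime_near_partition _ hk hX x0X).
  by move=> /(_ t.+1); rewrite IHt => /(Tprime_near_partition _ hk hX XX).
apply: cvg_near_cst; near=> t.
have t0 : (0 < t)%N by near: t; exact: nbhs_infty_gt.
by rewrite -(prednK t0) uX norm0.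
Unshelve. all: by end_near.
Qed.
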